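(* Let $V$ be a real $*$-vector space with a proper positive cone $V^+\subseteq V_{\rm sa}$ and an archimedean order unit. Then there exist a real operator system $\mathcal{S}$ and a unital order embedding $V\to\mathcal{S}$. Conversely, any real operator system is a real $*$-vector space with a (proper) positive cone $V^+\subseteq V_{\rm sa}$ and archimedean order unit.
   Context: A real $*$-vector space is a real vector space $V$ with a real linear involution $x\mapsto x^*$, $(x^* )^*=x$; $V_{\rm sa}=\{x:x=x^*\}$. A cone $V^+\subseteq V_{\rm sa}$ (closed under addition and multiplication by nonnegative reals) is proper if $V^+\cap-V^+=\{0\}$. An element $e\in V_{\rm sa}$ is an order unit if for every $x\in V_{\rm sa}$ there is $t>0$ with $te+x\in V^+$; it is archimedean if $x\in V_{\rm sa}$ and $te+x\in V^+$ for all $t>0$ imply $x\in V^+$. A real operator system is a unital selfadjoint real subspace $\mathcal{S}$ of $B(H)$ for a real Hilbert space $H$ (up to unital complete order isomorphism), with first-level cone $\mathcal{S}^+$ consisting of its positive operators (selfadjoint $x$ with $\langle xh,h\rangle\ge0$ for all $h\in H$), and unit the identity operator. A unital order embedding is an injective selfadjoint real linear map $u$ taking the order unit to the unit with $x\in V^+$ if and only if $u(x)\in\mathcal{S}^+$.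
   Formalization: The forward direction additionally assumes that the order unit e is nonzero unless V = 0; otherwise it is false, e.g. for V = R with x* = −x, V⁺ = {0}, e = 0, where a unital map sends 0 to the identity and so forces H = 0. *)

(* Defs.v *)
From HB Require Import structures.
From mathcomp Require Import all_boot all_order all_algebra.
From mathcomp Require Import all_classical all_reals all_analysis.

Set Implicit Arguments.
Unset Strict Implicit.
Unset Printing Implicit Defensive.

Import Order.TTheory GRing.Theory Num.Theory.
Import numFieldNormedType.Exports.

Local Open Scope classical_set_scope.
Local Open Scope ring_scope.

Section StarVectorSpaces.
Variables (R : realType) (V : lmodType R).
Implicit Types (star : V -> V) (C : set V) (e : V).

Definition star_vector_space star : Prop := linear star /\ involutive star.

Definition selfadjoint_part star : set V := [set x | star x = x].

Definition is_cone star C : Prop :=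
  [/\ C `<=` selfadjoint_part star,
      forall x y, C x -> C y -> C (x + y) &
      forall (t : R) x, 0 <= t -> C x -> C (t *: x)].

Definition proper_cone C : Prop := C `&` [set x | C (- x)] = [set 0].

Definition order_unit star C e : Prop :=
  selfadjoint_part star e /\
  forall x, selfadjoint_part star x -> exists2 t : R, 0 < t & C (t *: e + x).

Definition archimedean star C e : Prop :=
  forall x, selfadjoint_part star x ->
    (forall t : R, 0 < t -> C (t *: e + x)) -> C x.

Record archimedean_order_unit_space star C e : Prop := {
  aou_star : star_vector_space star ;
  aou_cone : is_cone star C ;
  aou_proper : proper_cone C ;
  aou_unit : order_unit star C e ;
  aou_archimedean : archimedean star C e }.

End StarVectorSpaces.

Section UnitalOrderEmbedding.
Variables (R : realType) (V W : lmodType R).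

Record unital_order_embedding
    (starV : V -> V) (posV : set V) (eV : V)
    (starW : W -> W) (posW : set W) (eW : W) (u : {linear V -> W}) : Prop := {
  uoe_injective : injective u ;
  uoe_star : forall x, u (starV x) = starW (u x) ;
  uoe_unital : u eV = eW ;
  uoe_order : forall x, posV x <-> posW (u x) }.

End UnitalOrderEmbedding.

(* [{dot H for idfun}] is the library type of symmetric, bilinear, positive
   definite forms; the last field says that the norm of the complete normed
   space is the one induced by the form. *)
Record real_hilbert (R : realType) := RealHilbert {
  hilbert_space :> completeNormedModType R ;
  hdot : {dot hilbert_space for idfun} ;
  hdot_norm : forall x : hilbert_space, `|x| ^+ 2 = hdot x x }.

Section Operators.
Variables (R : realType) (H : real_hilbert R).
Implicit Types T : H -> H.

Definition bounded_operator T : Prop :=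
  linear T /\ exists M : R, forall h, `|T h| <= M * `|h|.

(* [is_adjoint T T'] means T' = T^*; the form being nondegenerate, T' is
   determined by T. *)
Definition is_adjoint T T' : Prop :=
  forall h k : H, hdot H (T h) k = hdot H h (T' k).

(* Operators are functions [H -> H] with the pointwise vector space structure. *)
Record operator_system := OperatorSystem {
  opsys_set : set (H -> H) ;
  opsys_bounded : opsys_set `<=` bounded_operator ;
  opsys_zero : opsys_set 0 ;
  opsys_linear : forall (a : R) T T',
    opsys_set T -> opsys_set T' -> opsys_set (a *: T + T') ;
  opsys_unital : opsys_set idfun ;
  opsys_selfadjoint : forall T, opsys_set T ->
    exists2 T', opsys_set T' & is_adjoint T T' }.

Definition opsys_pred (S : operator_system) : {pred (H -> H)} :=
  fun T => T \in opsys_set S.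

Lemma opsys_submod_closed (S : operator_system) : submod_closed (opsys_pred S).
Proof.
split=> [|a T T' ST ST']; apply: mem_set; first exact: opsys_zero.
by apply: opsys_linear; apply: set_mem.
Qed.

HB.instance Definition _ (S : operator_system) :=
  GRing.isSubmodClosed.Build R (H -> H) (opsys_pred S) (opsys_submod_closed S).

Definition opsys_sort (S : operator_system) : Type :=
  {T : H -> H | T \in opsys_pred S}.

HB.instance Definition _ (S : operator_system) :=
  [isSub of opsys_sort S for @sval _ _].
HB.instance Definition _ (S : operator_system) :=
  [Choice of opsys_sort S by <:].
HB.instance Definition _ (S : operator_system) :=
  [SubChoice_isSubLmodule of opsys_sort S by <:].

End Operators.

Coercion opsys_sort : operator_system >-> Sortclass.

Section OperatorSystemStructure.
Variables (R : realType) (H : real_hilbert R) (S : operator_system H).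

(* The default value 0 is never used, by [opsys_starP]. *)
Definition opsys_star (x : S) : S :=
  xget 0 [set y : S | is_adjoint (val x) (val y)].

Lemma opsys_starP (x : S) : is_adjoint (val x) (val (opsys_star x)).
Proof.
have [T' ST' adjT'] := opsys_selfadjoint (set_mem (valP x)).
pose y : S := Sub T' (mem_set ST').
have adjy : [set y : S | is_adjoint (val x) (val y)] y by [].
exact: (xgetPex (0 : S) (ex_intro _ y adjy)).
Qed.

Definition opsys_one : S := Sub idfun (mem_set (opsys_unital S)).

Definition opsys_pos : set S :=
  [set x | opsys_star x = x /\ forall h : H, 0 <= hdot H (val x h) h].

End OperatorSystemStructure.

Arguments opsys_star {R H} S x.
Arguments opsys_one {R H} S.
Arguments opsys_pos {R H} S.

(* Main.v *)
(* A self-adjoint x outside the positive cone leaves some t e + x outside it.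
   Zorn's lemma enlarges the cone generated by the positive elements and by
   -(t e + x) to a total one still missing -e, and cutting that cone along e
   defines a state that is negative at x.  Hence the diagonal operators with
   entries f x, f a state, represent the order of V_sa.  Skew elements carry no
   order and only have to be represented injectively: V embeds linearly into the
   bounded functions on a set (Zorn again), and for each state f and each
   coordinate g of this embedding, composed with the map from x to x - x^*,
   x acts on a plane by the matrix [[f x, g x], [- g x, f x]].  The sum of these
   planes is the Hilbert space of square-summable families. *)
Require Import Defs.
From HB Require Import structures.
From mathcomp Require Import all_boot all_order all_algebra.
From mathcomp Require Import all_classical all_reals all_analysis.
From mathcomp Require Import ring lra.

Set Implicit Arguments.
Unset Strict Implicit.
Unset Printing Implicit Defensive.

Import Order.TTheory GRing.Theory Num.Theory.
Import numFieldNormedType.Exports.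

Local Open Scope classical_set_scope.
Local Open Scope ring_scope.

(** * Real operator systems as order unit spaces *)

Section HilbertForm.
Variables (R : realType) (H : real_hilbert R).
Implicit Types h k : H.

Lemma hdotC h k : hdot H h k = hdot H k h.
Proof. by rewrite (hermitian_subproof h k) expr0 mul1r. Qed.

Lemma hdotDl h1 h2 k : hdot H (h1 + h2) k = hdot H h1 k + hdot H h2 k.
Proof. by rewrite linearDl. Qed.

Lemma hdotZl (c : R) h k : hdot H (c *: h) k = c * hdot H h k.
Proof. by rewrite linearZl. Qed.

Lemma hdotDr h k1 k2 : hdot H h (k1 + k2) = hdot H h k1 + hdot H h k2.
Proof. by rewrite !(hdotC h) hdotDl. Qed.

Lemma hdotZr (c : R) h k : hdot H h (c *: k) = c * hdot H h k.
Proof. by rewrite !(hdotC h) hdotZl. Qed.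

Lemma hdot_eq0 h : hdot H h h = 0 -> h = 0.
Proof. by rewrite -hdot_norm => /eqP; rewrite sqrf_eq0 normr_eq0 => /eqP. Qed.

Lemma hdot_ge0 h : 0 <= hdot H h h.
Proof. by rewrite -hdot_norm sqr_ge0. Qed.

Lemma adjoint_unique (T T1 T2 : H -> H) :
  is_adjoint T T1 -> is_adjoint T T2 -> T1 = T2.
Proof.
move=> adj1 adj2; apply/funext => k; apply/eqP; rewrite -subr_eq0; apply/eqP.
apply: hdot_eq0; rewrite -[- T2 k]scaleN1r hdotDr hdotZr.
by rewrite -adj1 -adj2 mulN1r subrr.
Qed.

Lemma adjoint_sym (T T' : H -> H) : is_adjoint T T' -> is_adjoint T' T.
Proof. by move=> adj h k; rewrite hdotC -adj hdotC. Qed.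

(** Expanding [0 <= <T h + h, T h + h>] and bounding [<T h, T h>] by [M ^+ 2 * <h, h>] controls
    [<T h, h>] from below. The constant is positive whatever the sign of [M], so it can serve as the
    multiple of the order unit. *)
Lemma form_lower_bound (T : H -> H) (M : R) :
  (forall h, `|T h| <= M * `|h|) ->
  forall h, 0 <= (M ^+ 2 + 1) * hdot H h h + hdot H (T h) h.
Proof.
move=> TM h.
have TM2 : hdot H (T h) (T h) <= M ^+ 2 * hdot H h h.
  rewrite -!hdot_norm -exprMn ler_pXn2r// nnegrE//.
  exact: le_trans (TM h).
have := hdot_ge0 (T h + h); have := hdot_ge0 h.
have : 0 <= M ^+ 2 * hdot H h h by rewrite mulr_ge0 ?sqr_ge0// hdot_ge0.
rewrite !hdotDl !hdotDr (hdotC h (T h)) mulrDl mul1r.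
move: TM2; move: (hdot H h h) (hdot H (T h) h) (hdot H (T h) (T h)).
by move: (M ^+ 2) => *; nra.
Qed.

(** The form at [h + T h] reduces to [2 * <T h, T h>], by symmetry. This makes the positive cone
    proper: if [x] and [- x] are positive, the form of [x] vanishes. *)
Lemma symmetric_form_eq0 (T : H -> H) : linear T -> is_adjoint T T ->
  (forall h, hdot H (T h) h = 0) -> T = 0.
Proof.
move=> linT adjT T0; apply/funext => h; apply: hdot_eq0.
have := T0 (1 *: h + T h); rewrite linT !hdotDl !hdotDr !hdotZl !hdotZr.
rewrite !T0 (adjT (T h) h).
move: (hdot _ _ _) => d; lra.
Qed.

End HilbertForm.

Section OperatorSystemOrder.
Variables (R : realType) (H : real_hilbert R) (S : operator_system H).
Implicit Types (x y : S) (h : H).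

Lemma opsys_valE (c : R) x y h : val (c *: x + y) h = c *: val x h + val y h.
Proof. by []. Qed.

Lemma opsys_valD x y h : val (x + y) h = val x h + val y h.
Proof. by []. Qed.

Lemma opsys_valZ (c : R) x h : val (c *: x) h = c *: val x h.
Proof. by []. Qed.

Lemma opsys_starE x y : is_adjoint (val x) (val y) -> opsys_star S x = y.
Proof.
by move=> adj; apply/val_inj/(adjoint_unique _ adj); exact: opsys_starP.
Qed.

Lemma opsys_star_vector_space : star_vector_space (opsys_star S).
Proof.
split=> [c x y|x]; apply: opsys_starE; last exact/adjoint_sym/opsys_starP.
move=> h k; rewrite !opsys_valE hdotDl hdotZl hdotDr hdotZr.
by rewrite !opsys_starP.
Qed.

Lemma opsys_aou :
  archimedean_order_unit_space (opsys_star S) (opsys_pos S) (opsys_one S).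
Proof.
have [starL starK] := opsys_star_vector_space.
have starD x y : opsys_star S (x + y) = opsys_star S x + opsys_star S y.
  by rewrite -[x in LHS]scale1r starL scale1r.
have star0 : opsys_star S 0 = 0.
  by apply: (addrI (opsys_star S 0)); rewrite -starD !addr0.
have starZ (c : R) x : opsys_star S (c *: x) = c *: opsys_star S x.
  by rewrite -[c *: x]addr0 starL star0 addr0.
have star1 : opsys_star S (opsys_one S) = opsys_one S by exact: opsys_starE.
have selfadj x : opsys_star S x = x -> is_adjoint (val x) (val x).
  by move=> x_sa; rewrite -[x in X in is_adjoint _ X]x_sa; exact: opsys_starP.
have one_form (t : R) x h : hdot H (val (t *: opsys_one S + x) h) h =
    t * hdot H h h + hdot H (val x h) h.
  by rewrite opsys_valE hdotDl hdotZl.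
split.
- exact: opsys_star_vector_space.
- split=> [x []//|x y [xs xp] [ys yp]|t x t0 [xs xp]].
    split=> [|h]; first by rewrite starD xs ys.
    by rewrite opsys_valD hdotDl addr_ge0.
  split=> [|h]; first by rewrite starZ xs.
  by rewrite opsys_valZ hdotZl mulr_ge0.
- apply/seteqP; split=> [x [[xs xp] [_ xn]]|_ ->]; last first.
    by split; rewrite /= ?oppr0; split=> // h;
      rewrite -(scale0r (0 : S)) opsys_valZ hdotZl mul0r.
  apply/val_inj/symmetric_form_eq0.
  + by have [] := opsys_bounded (set_mem (valP x)).
  + exact: selfadj.
  + move=> h; apply/eqP; rewrite eq_le xp andbT.
    by have := xn h; rewrite -scaleN1r opsys_valZ hdotZl mulN1r oppr_ge0.
- split=> // x xs; have [_ [M xM]] := opsys_bounded (set_mem (valP x)).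
  exists (M ^+ 2 + 1); first by rewrite ltr_wpDl// sqr_ge0.
  split=> [|h]; first by rewrite starL star1 xs.
  by rewrite one_form form_lower_bound.
- move=> x xs tx; split=> // h; apply/ler_addgt0Pl => eps eps0.
  (* The multiple of the unit is [eps / (<h, h> + 1)], so that it adds at most [eps] to the form;
     the [+ 1] covers [h = 0]. *)
  have hh1 : 0 < hdot H h h + 1 by rewrite ltr_wpDl// hdot_ge0.
  have [_ /(_ h)] := tx _ (divr_gt0 eps0 hh1); rewrite one_form => ge0.
  apply: le_trans ge0 _; rewrite lerD2r mulrAC ler_pdivrMr//.
  by rewrite ler_pM2l// lerDl.
Qed.
End OperatorSystemOrder.

(** * States on totally ordered cones *)

Section StateExistence.
Variables (R : realType) (V : lmodType R).
Implicit Types (C D : set V) (e x y v w : V).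

Definition convex_cone C : Prop :=
  (forall x y, C x -> C y -> C (x + y)) /\
  (forall (t : R) x, 0 <= t -> C x -> C (t *: x)).

Lemma convex_cone_addray C v : convex_cone C ->
  convex_cone [set x | exists c (s : R), [/\ C c, 0 <= s & x = c + s *: v]].
Proof.
move=> [CD CZ]; split => [_ _ [c [s [Cc s0 ->]]] [d [t [Cd t0 ->]]]|].
  exists (c + d), (s + t); split; [exact: CD|exact: addr_ge0|].
  by rewrite scalerDl addrACA.
move=> t _ t0 [c [s [Cc s0 ->]]]; exists (t *: c), (t * s).
by split; [exact: CZ|exact: mulr_ge0|rewrite scalerDr scalerA].
Qed.

(** A maximal cone missing [x0] is total. If it contained neither [v] nor [- v], adjoining either
    ray would capture [x0], so [x0 = c + s v = d - t v] with [c], [d] in the cone. Eliminating [v]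
    then puts [x0] in the cone. *)
Lemma total_cone_extension C x0 : convex_cone C -> C 0 -> ~ C x0 ->
  exists D, [/\ convex_cone D, C `<=` D, ~ D x0 & forall v, D v \/ D (- v)].
Proof.
move=> coneC C0 nCx0.
(* The conditions bear on the union of [A] with [C] because the empty chain has empty union, which
   does not contain [C]. *)
have [F FP Ftot|A [[coneA nAx0] Amax]] := @Zorn_bigcup V
    [set A | convex_cone (A `|` C) /\ ~ (A `|` C) x0].
  split; last first.
    by move=> [[X FX Xx0]|//]; have [_ []] := FP _ FX; left.
  split=> [x y|t x t0].
    move=> [[X FX Xx]|Cx] [[Y FY Yy]|Cy].
    - have [XY|YX] := Ftot _ _ FX FY.
      + have [[+ _] _] := FP _ FY.
        by move=> /(_ x y (or_introl (XY _ Xx)) (or_introl Yy)) [];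
          [left; exists Y|right].
      + have [[+ _] _] := FP _ FX.
        by move=> /(_ x y (or_introl Xx) (or_introl (YX _ Yy))) [];
          [left; exists X|right].
    - have [[+ _] _] := FP _ FX.
      by move=> /(_ x y (or_introl Xx) (or_intror Cy)) [];
        [left; exists X|right].
    - have [[+ _] _] := FP _ FY.
      by move=> /(_ x y (or_intror Cx) (or_introl Yy)) [];
        [left; exists Y|right].
    - by right; apply: coneC.1.
  move=> [[X FX Xx]|Cx]; last by right; apply: coneC.2.
  have [[_ +] _] := FP _ FX.
  by move=> /(_ t x t0 (or_introl Xx)) []; [left; exists X|right].
exists (A `|` C); split=> //.
pose ray v :=
  [set x | exists c (s : R), [/\ (A `|` C) c, 0 <= s & x = c + s *: v]].
have ray_incl v : A `|` C `<=` ray v.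
  by move=> x ACx; exists x, 0; rewrite scale0r addr0.
have ray_x0 v : ~ (A `|` C) v -> ray v x0.
  move=> nv; apply: contrapT => nx0; apply: (Amax (ray v)).
    split; first by move=> x Ax; apply: ray_incl; left.
    move=> /(_ v) h; apply: nv; left; apply: h.
    by exists 0, 1; rewrite scale1r add0r; split=> //; right.
  have rayC : ray v `|` C = ray v.
    by apply/setUidPl => x Cx; apply: ray_incl; right.
  by split; rewrite rayC//; exact: convex_cone_addray.
move=> v; have [|nv] := pselect ((A `|` C) v); first by left.
right; apply: contrapT => nNv.
have [c [s [ACc s0 x0E]]] := ray_x0 _ nv.
have [d [t [ACd t0 x0E']]] := ray_x0 _ nNv.
have s_gt0 : 0 < s.
  rewrite lt_neqAle s0 andbT; apply: contra_notN nAx0 => /eqP s00.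
  by rewrite x0E -s00 scale0r addr0.
(* Weighting the two expressions of [x0] by [t] and [s] cancels [v]. *)
apply: nAx0; have -> : x0 = (s + t)^-1 *: (t *: c + s *: d).
  have st0 : s + t != 0 by rewrite gt_eqF// ltr_pwDl.
  apply: (scalerI st0); rewrite scalerA divff// scale1r.
  have -> : (s + t) *: x0 = (t *: c + (t * s) *: v) + (s *: d - (t * s) *: v).
    rewrite scalerDl {1}x0E' {1}x0E !scalerDr !scalerN !scalerA [s * t]mulrC.
    by rewrite addrC.
  by rewrite addrACA subrr addr0.
apply: coneA.2; first by rewrite invr_ge0 addr_ge0.
by apply: coneA.1; apply: coneA.2.
Qed.

(** A total cone cuts each line [v - t e] at one threshold: [f v] is the supremum of the [t] with
    [v - t e] in [D]. The order unit makes this supremum finite, and [~ D (- e)] makes the threshold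
    unique. *)
Lemma total_cone_state D e : convex_cone D -> ~ D (- e) ->
    (forall v, D v \/ D (- v)) ->
    (forall v, exists2 t : R, 0 < t & D (t *: e + v)) ->
  exists f : V -> R,
    [/\ linear (f : V -> R^o), f e = 1 & forall v, D v -> 0 <= f v].
Proof.
move=> [DD DZ] nDe Dtot De.
have D_ge0 r : D (r *: e) -> 0 <= r.
  move=> Dr; rewrite leNgt; apply/negP => r0; apply: nDe.
  have -> : - e = (- r)^-1 *: (r *: e).
    by rewrite scalerA invrN mulNr mulVf ?lt_eqF// scaleN1r.
  by apply: DZ => //; rewrite invr_ge0 oppr_ge0 ltW.
have De0 : D e.
  by case: (Dtot e) => // /nDe.
(* [val_at v r] says that [v - r e] is infinitesimal with respect to [e]. Since [r] is unique,
   linearity of [f] only requires that infinitesimals be stable under linear combinations. *)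
pose val_at v (r : R) := forall eps, 0 < eps ->
  D (eps *: e + (v - r *: e)) /\ D (eps *: e - (v - r *: e)).
have val_le v r r' : val_at v r -> val_at v r' -> r <= r'.
  move=> vr vr'; apply/ler_addgt0Pl => eps eps0.
  have eps20 : 0 < eps / 2 by rewrite divr_gt0.
  have [h _] := vr _ eps20; have [_ h'] := vr' _ eps20.
  rewrite -subr_ge0; apply: D_ge0; have := DD _ _ h h'.
  congr (D _); rewrite addrACA -scalerDl -splitr opprB scalerBl scalerDl.
  by rewrite -[RHS]addrA; congr (_ + _); rewrite addrC addrA subrK.
have infinitesimalZ y : (forall eps, 0 < eps -> D (eps *: e + y)) ->
    forall a : R, 0 <= a -> forall eps, 0 < eps -> D (eps *: e + a *: y).
  (* Of the [a + 1] shares of [eps / (a + 1)], [a] go with [y] and one remains on [e]; this also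
     covers [a = 0]. *)
  move=> Dy a a0 eps eps0; have a1 : 0 < a + 1 by rewrite ltr_wpDl.
  have -> : eps *: e + a *: y = (eps / (a + 1)) *: e +
      a *: ((eps / (a + 1)) *: e + y).
    rewrite scalerDr scalerA addrA -scalerDl; congr (_ *: _ + _).
    by field; rewrite gt_eqF.
  have eps1 : 0 < eps / (a + 1) by rewrite divr_gt0.
  by apply: DD; [apply: DZ => //; exact: ltW|apply: DZ => //; exact: Dy].
have val_ex v : exists r, val_at v r.
  pose S := [set t : R | D (v - t *: e)].
  have supS : has_sup S.
    split.
      have [t _ Dt] := De v; exists (- t).
      by rewrite /S /= scaleNr opprK addrC.
    have [s _ Ds] := De (- v); exists s => t Dt.
    rewrite -subr_ge0; apply: D_ge0; have := DD _ _ Ds Dt.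
    by rewrite addrA subrK scalerBl.
  exists (sup S) => eps eps0; split.
    have [t St tlt] := sup_adherent eps0 supS.
    have -> : eps *: e + (v - sup S *: e) =
        (v - t *: e) + (t - (sup S - eps)) *: e.
      rewrite addrC !scalerBl opprB addrA subrK.
      by rewrite -addrA [- _ + _]addrC.
    by apply: DD => //; apply: DZ => //; rewrite subr_ge0 ltW.
  (* By totality, failure of the upper bound would put [sup S + eps] in [S]. *)
  case: (Dtot (eps *: e - (v - sup S *: e))) => //; rewrite opprB opprB.
  rewrite -addrA -opprD -scalerDl => Dv.
  have := ub_le_sup supS.2 Dv; rewrite gerDl leNgt.
  by rewrite eps0.
have [f fP] := choice val_ex.
have fE v r : val_at v r -> f v = r.
  by move=> vr; apply/eqP; rewrite eq_le !(val_le v).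
exists f; split.
- move=> a v w; apply: fE => eps eps0.
  have eps20 : 0 < eps / 2 by rewrite divr_gt0.
  have -> : a *: v + w - (a *: f v + f w) *: e =
      a *: (v - f v *: e) + (w - f w *: e).
    by rewrite scalerDl opprD addrACA scalerBr scalerA.
  have [wp wn] := fP w _ eps20.
  have vp := infinitesimalZ _ (fun eps h => (fP v eps h).1).
  have vn := infinitesimalZ _ (fun eps h => (fP v eps h).2).
  have {vp vn} [vp vn] : D ((eps / 2) *: e + a *: (v - f v *: e)) /\
      D ((eps / 2) *: e - a *: (v - f v *: e)).
    have [a0|a0] := leP 0 a.
      by split; [exact: vp|rewrite -scalerN; exact: vn].
    have Na0 : 0 <= - a by rewrite oppr_ge0 ltW.
    split; last by rewrite -scaleNr; exact: vp.
    by rewrite -[a]opprK scaleNr -scalerN; exact: vn.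
  rewrite [eps in X in X /\ _]splitr [eps in X in _ /\ X]splitr.
  by rewrite scalerDl opprD; split; rewrite addrACA; apply: DD.
- apply: fE => eps eps0; rewrite scale1r subrr subr0 addr0.
  by split; apply: DZ => //; exact: ltW.
- move=> v Dv; apply/ler_addgt0Pl => eps eps0; apply: D_ge0.
  have [_ h] := fP v _ eps0.
  have := DD _ _ h Dv; congr (D _).
  by rewrite opprB addrA subrK scalerDl.
Qed.
End StateExistence.

(** * Embedding a vector space into bounded functions *)

Section BoundedInjection.
Variables (R : realType) (V : lmodType R).

Let partial_injection (G : set (V * (V -> R^o))) : Prop :=
  [/\ forall (a : R) p q, G p -> G q -> G (a *: p + q),
      forall p, G p -> (p.1 = 0 <-> p.2 = 0),
      forall p, G p -> exists M : R, forall z, `|p.2 z| <= M &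
      (* leaves the coordinates outside the domain free for an extension *)
      forall p z, G p -> p.2 z != 0 -> exists y, G (z, y)].

Lemma bounded_function_embedding : exists phi : V -> V -> R,
  [/\ forall z, linear ((phi^~ z) : V -> R^o),
      forall x, exists M : R, forall z, `|phi x z| <= M &
      forall x, (forall z, phi x z = 0) -> x = 0].
Proof.
have [F FP Ftot|A [[AL Ainj Abd Asupp] Amax]] :=
  @Zorn_bigcup _ partial_injection.
  split.
  - move=> a p q [X FX Xp] [Y FY Yq].
    have [XY|YX] := Ftot _ _ FX FY.
      by have [YL _ _ _] := FP _ FY; exists Y => //; apply: YL => //; exact: XY.
    by have [XL _ _ _] := FP _ FX; exists X => //; apply: XL => //; exact: YX.
  - by move=> p [X FX Xp]; have [_ + _ _] := FP _ FX; exact.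
  - by move=> p [X FX Xp]; have [_ _ + _] := FP _ FX; exact.
  - move=> p z [X FX Xp] pz; have [_ _ _ /(_ p z Xp pz)] := FP _ FX.
    by move=> [y Xy]; exists y, X.
(* The empty graph satisfies all the conditions, so it is excluded by comparison with the graph
   reduced to [0]. *)
have A0 : A 0.
  apply: contrapT => nA0; have A_empty p : ~ A p.
    by move=> Ap; apply: nA0; rewrite -(addNr p) -scaleN1r; exact: AL.
  apply: (Amax [set 0]).
    by split=> [p /A_empty//|/(_ 0 erefl)].
  split.
  - by move=> a _ _ -> ->; rewrite /= scaler0 addr0.
  - by move=> _ ->.
  - by move=> _ ->; exists 0 => z; rewrite normr0.
  - by move=> _ z ->; rewrite eqxx.
have Atotal x : exists y, A (x, y).
  apply: contrapT => nx.
  pose d : V * (V -> R^o) := (x, fun z => (z == x)%:R).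
  have px p : A p -> p.2 x = 0.
    move=> Ap; apply/eqP/negPn/negP => /(Asupp _ _ Ap) [y Axy].
    by apply: nx; exists y.
  apply: (Amax [set p | exists q (t : R), A q /\ p = q + t *: d]).
    split=> [p Ap|]; first by exists p, 0; rewrite scale0r addr0.
    move=> /(_ d) h; apply: nx; exists d.2; apply: h.
    by exists 0, 1; rewrite scale1r add0r.
  split.
  - move=> a _ _ [q [t [Aq ->]]] [q' [t' [Aq' ->]]].
    exists (a *: q + q'), (a * t + t'); split; first exact: AL.
    by rewrite scalerDr scalerDl scalerA addrACA.
  - move=> _ [q [t [Aq ->]]] /=.
    have [->|t0] := eqVneq t 0; first by rewrite !scale0r !addr0; exact: Ainj.
    split=> [q1|/(congr1 (fun f => f x))].
      (* Here [q.1 + t x = 0] with [t != 0], so [x] would already be in the domain. In the converse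
         direction, the value at the coordinate [x] is [t], which cannot vanish. *)
      case: nx; exists (- t^-1 *: q.2).
      have -> : (x, - t^-1 *: q.2) = - t^-1 *: q + 0.
        rewrite addr0; congr pair => /=; apply: (scalerI t0).
        rewrite scalerA mulrN divff// scaleN1r; apply/eqP.
        by rewrite -addr_eq0 addrC q1.
      exact: AL.
    rewrite -[LHS]/(q.2 x + t * (x == x)%:R) px// add0r eqxx => /eqP.
    by rewrite mulr1 (negPf t0).
  - move=> _ [q [t [Aq ->]]]; have [M qM] := Abd _ Aq.
    exists (M + `|t|) => z /=; apply: (le_trans (ler_normD _ _)).
    apply: lerD => //; rewrite normrM -[leRHS]mulr1 ler_wpM2l//.
    by case: eqP; rewrite ?normr1 ?normr0.
  - move=> _ z [q [t [Aq ->]]] /=.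
    have [->|zx] := eqVneq z x.
      by exists d.2, 0, 1; rewrite scale1r add0r.
    rewrite -[X in X != 0]/(q.2 z + t * (z == x)%:R) (negPf zx) mulr0 addr0.
    move=> /(Asupp _ _ Aq) [y Ay].
    by exists y, (z, y), 0; rewrite scale0r addr0.
have [phi phiP] := choice Atotal.
have phiL a x y : phi (a *: x + y) = a *: phi x + phi y.
  apply/eqP; rewrite -subr_eq0; apply/eqP.
  (* The defect of linearity is the second component of a graph element whose first component is
     [0]. *)
  pose p := - 1 *: (a *: (x, phi x) + (y, phi y)) +
    (a *: x + y, phi (a *: x + y)).
  have Ap : A p by apply: (AL) => //; exact: AL.
  have /= := Ainj _ Ap; rewrite !scaleN1r addNr => -[/(_ erefl) + _].
  by rewrite addrC.
exists phi; split.
- by move=> z a x y /=; rewrite phiL.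
- by move=> x; exact: Abd (phiP x).
- move=> x phix; apply/(Ainj _ (phiP x)) => /=.
  exact/funext.
Qed.
End BoundedInjection.

(** * The Hilbert space of square-summable families *)

Section NonnegativeSums.
Variables (R : realType) (I : choiceType).
Implicit Types (a b : I -> R) (s : seq I).

Definition bounded_sums a : Prop :=
  exists M : R, forall s, uniq s -> \sum_(i <- s) a i <= M.

(** For a nonnegative family with [bounded_sums] this is the unordered sum; for a signed one it
    would be the sum of the positive parts. Hence only sums of squares are formed below. *)
Definition family_sum a : R :=
  sup [set r | exists2 s, uniq s & r = \sum_(i <- s) a i].

Lemma family_sum_has_sup a : bounded_sums a ->
  has_sup [set r | exists2 s, uniq s & r = \sum_(i <- s) a i].
Proof.
move=> [M aM]; split; first by exists 0, [::]; rewrite ?big_nil.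
by exists M => _ [s us ->]; exact: aM.
Qed.

Lemma family_sum_ub a s : bounded_sums a -> uniq s ->
  \sum_(i <- s) a i <= family_sum a.
Proof.
move=> /family_sum_has_sup[_ ubS] us.
by apply: ub_le_sup => //; exists s.
Qed.

Lemma family_sum_le a M : (forall s, uniq s -> \sum_(i <- s) a i <= M) ->
  family_sum a <= M.
Proof.
move=> aM; apply: ge_sup; first by exists 0, [::]; rewrite ?big_nil.
by move=> _ [s us ->]; exact: aM.
Qed.

Lemma le_bounded_sums a b : (forall i, a i <= b i) -> bounded_sums b ->
  bounded_sums a.
Proof.
move=> ab [M bM]; exists M => s us.
by rewrite (le_trans _ (bM _ us))// ler_sum.
Qed.

Lemma bounded_sumsD a b : bounded_sums a -> bounded_sums b ->
  bounded_sums (fun i => a i + b i).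
Proof.
move=> [M aM] [N bN]; exists (M + N) => s us.
by rewrite big_split lerD// (aM, bN).
Qed.

Lemma bounded_sumsZ (c : R) a : 0 <= c -> bounded_sums a ->
  bounded_sums (fun i => c * a i).
Proof.
move=> c0 [M aM]; exists (c * M) => s us.
by rewrite -mulr_sumr ler_wpM2l// aM.
Qed.

Lemma le_family_sum a b : (forall i, a i <= b i) -> bounded_sums b ->
  family_sum a <= family_sum b.
Proof.
move=> ab bb; apply: family_sum_le => s us.
by rewrite (le_trans _ (family_sum_ub bb us))// ler_sum.
Qed.

Lemma le_sum_seq a s t : (forall i, 0 <= a i) -> uniq s -> {subset s <= t} ->
  \sum_(i <- s) a i <= \sum_(i <- t) a i.
Proof.
move=> a0; elim: s t => [|x s IHs] t; first by rewrite big_nil sumr_ge0.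
move=> /andP[xs us] st.
rewrite big_cons [leRHS](big_rem x) ?st ?mem_head//= lerD2l.
apply: IHs => // y ys; apply: rem_mem; last by rewrite st// inE ys orbT.
by apply: contraNneq xs => <-.
Qed.

(** For the lower bound, a list for [a] and a list for [b] are merged without duplicates; by
    nonnegativity the merged list dominates both. *)
Lemma family_sumD a b : (forall i, 0 <= a i) -> (forall i, 0 <= b i) ->
  bounded_sums a -> bounded_sums b ->
  family_sum (fun i => a i + b i) = family_sum a + family_sum b.
Proof.
move=> a0 b0 ba bb; apply/eqP; rewrite eq_le; apply/andP; split.
  by apply: family_sum_le => s us; rewrite big_split lerD// family_sum_ub.
rewrite -lerBrDr; apply: family_sum_le => s us.
rewrite lerBrDr -lerBrDl; apply: family_sum_le => t ut.
rewrite lerBrDl.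
have ust : uniq (undup (s ++ t)) by exact: undup_uniq.
apply: le_trans (family_sum_ub (bounded_sumsD ba bb) ust).
rewrite big_split lerD//; apply: le_sum_seq => // i;
  by rewrite mem_undup mem_cat => ->; rewrite ?orbT.
Qed.

Lemma family_sumZ (c : R) a : 0 <= c -> bounded_sums a ->
  family_sum (fun i => c * a i) = c * family_sum a.
Proof.
rewrite le_eqVlt => /predU1P[<- _|c0 ba].
  rewrite mul0r; apply/eqP; rewrite eq_le; apply/andP; split.
    by apply: family_sum_le => s us; rewrite big1// => i _; rewrite mul0r.
  have := @family_sum_ub (fun i => 0 * a i) [::]; rewrite big_nil; apply => //.
  by exists 0 => s us; rewrite big1// => i _; rewrite mul0r.
apply/eqP; rewrite eq_le; apply/andP; split.
  apply: family_sum_le => s us.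
  by rewrite -mulr_sumr ler_wpM2l ?(ltW c0)// family_sum_ub.
rewrite -ler_pdivlMl//; apply: family_sum_le => s us.
rewrite ler_pdivlMl// mulr_sumr; apply: family_sum_ub => //.
by apply: bounded_sumsZ; rewrite ?ltW.
Qed.
End NonnegativeSums.

Section SquareSummable.
Variables (R : realType) (I : choiceType).

Definition square_summable : {pred I -> R^o} :=
  fun f => `[< bounded_sums (fun i => f i ^+ 2) >].

Lemma square_summable_submod_closed : submod_closed square_summable.
Proof.
split=> [|c f g]; rewrite !unfold_in.
  by apply/asboolP; exists 0 => s _; rewrite big1// => i _; rewrite expr0n.
move=> /asboolP bf /asboolP bg; apply/asboolP.
apply: le_bounded_sums (bounded_sumsD (bounded_sumsZ (_ : 0 <= 2 * c ^+ 2) bf)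
    (bounded_sumsZ (_ : 0 <= 2) bg)) => // [i|];
  last by rewrite mulr_ge0// sqr_ge0.
rewrite -[(c *: f + g) i]/(c * f i + g i) -subr_ge0.
have -> : 2 * c ^+ 2 * f i ^+ 2 + 2 * g i ^+ 2 - (c * f i + g i) ^+ 2 =
  (c * f i - g i) ^+ 2 by ring.
exact: sqr_ge0.
Qed.

HB.instance Definition _ :=
  GRing.isSubmodClosed.Build R (I -> R^o) square_summable
    square_summable_submod_closed.

Definition ell2 : Type := {f : I -> R^o | f \in square_summable}.

HB.instance Definition _ := [isSub of ell2 for @sval _ _].
HB.instance Definition _ := [Choice of ell2 by <:].
HB.instance Definition _ := [SubChoice_isSubLmodule of ell2 by <:].
End SquareSummable.

(** * The inner product on square-summable families *)

Section InnerProduct.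
Variables (R : realType) (I : choiceType).
Local Notation H := (ell2 R I).
Implicit Types (f g h : H) (i : I).

Lemma ell2E (c : R) f g i : val (c *: f + g) i = c * val f i + val g i.
Proof. by []. Qed.
Lemma ell2D f g i : val (f + g) i = val f i + val g i.
Proof. by []. Qed.
Lemma ell2N f i : val (- f) i = - val f i.
Proof. by []. Qed.
Lemma ell2Z (c : R) f i : val (c *: f) i = c * val f i.
Proof. by []. Qed.

Definition norm2 f : R := family_sum (fun i => val f i ^+ 2).

Lemma norm2_bounded f : bounded_sums (fun i => val f i ^+ 2).
Proof. by have := valP f; rewrite unfold_in => /asboolP. Qed.

(** This transfers pointwise comparisons of finite sums of squares to squared norms, without summing
    a signed family. *)
Lemma sum_norm2 (s : seq H) :
  bounded_sums (fun i => \sum_(f <- s) val f i ^+ 2) /\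
  \sum_(f <- s) norm2 f = family_sum (fun i => \sum_(f <- s) val f i ^+ 2).
Proof.
elim: s => [|f s [bs IHs]].
  rewrite big_nil; under eq_fun do rewrite big_nil.
  have b0 : bounded_sums (fun _ : I => 0 : R) by exists 0 => s _; rewrite big1.
  by split=> //; have := family_sumZ (lexx 0) b0; rewrite !mul0r => ->.
rewrite big_cons; under eq_fun do rewrite big_cons.
split; first exact: bounded_sumsD (norm2_bounded f) bs.
rewrite IHs family_sumD//; last exact: norm2_bounded.
  by move=> i; exact: sqr_ge0.
by move=> i; apply: sumr_ge0 => *; exact: sqr_ge0.
Qed.

Lemma le_sum_norm2 (s t : seq H) :
  (forall i, \sum_(f <- s) val f i ^+ 2 <= \sum_(f <- t) val f i ^+ 2) ->
  \sum_(f <- s) norm2 f <= \sum_(f <- t) norm2 f.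
Proof.
move=> st; rewrite !(sum_norm2 _).2; apply: le_family_sum => //.
exact: (sum_norm2 _).1.
Qed.

Lemma eq_sum_norm2 (s t : seq H) :
  (forall i, \sum_(f <- s) val f i ^+ 2 = \sum_(f <- t) val f i ^+ 2) ->
  \sum_(f <- s) norm2 f = \sum_(f <- t) norm2 f.
Proof.
by move=> st; apply/eqP; rewrite eq_le !le_sum_norm2// => i; rewrite st.
Qed.

(** The hypothesis has only sums of squares; the conclusion has the differences that polarization
    produces. *)
Lemma norm2_identity2 (f1 f2 g1 g2 : H) :
  (forall i, val f1 i ^+ 2 + val f2 i ^+ 2 = val g1 i ^+ 2 + val g2 i ^+ 2) ->
  norm2 f1 - norm2 g1 = norm2 g2 - norm2 f2.
Proof.
move=> fg; have := @eq_sum_norm2 [:: f1; f2] [:: g1; g2].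
rewrite !big_cons !big_nil !addr0 => E.
apply/eqP; rewrite subr_eq addrAC eq_sym subr_eq eq_sym [eqbRHS]addrC.
apply/eqP.
by apply: E => i; rewrite !big_cons !big_nil !addr0.
Qed.

Lemma norm2_identity3 (f1 f2 f3 g1 g2 g3 : H) :
  (forall i, val f1 i ^+ 2 + val f2 i ^+ 2 + val f3 i ^+ 2 =
    val g1 i ^+ 2 + val g2 i ^+ 2 + val g3 i ^+ 2) ->
  norm2 f1 - norm2 g1 = (norm2 g2 - norm2 f2) + (norm2 g3 - norm2 f3).
Proof.
move=> fg; have := @eq_sum_norm2 [:: f1; f2; f3] [:: g1; g2; g3].
rewrite !big_cons !big_nil !addr0 !addrA => E.
have {fg}E : norm2 f1 + norm2 f2 + norm2 f3 = norm2 g1 + norm2 g2 + norm2 g3.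
  by apply: E => i; rewrite !big_cons !big_nil !addr0 !addrA.
move: E; move: (norm2 f1) (norm2 f2) (norm2 f3).
move: (norm2 g1) (norm2 g2) (norm2 g3).
by clear=> *; lra.
Qed.

Lemma norm2Z (c : R) f : norm2 (c *: f) = c ^+ 2 * norm2 f.
Proof.
rewrite /norm2 -family_sumZ ?sqr_ge0//; last exact: norm2_bounded.
by congr family_sum; apply/funext => i; rewrite ell2Z exprMn.
Qed.

Lemma norm2N f : norm2 (- f) = norm2 f.
Proof. by rewrite -scaleN1r norm2Z sqrrN expr1n mul1r. Qed.

Lemma coord_le_norm2 f i : val f i ^+ 2 <= norm2 f.
Proof.
have := @family_sum_ub _ _ _ [:: i] (norm2_bounded f).
by rewrite big_seq1; apply.
Qed.

Lemma norm2_ge0 f : 0 <= norm2 f.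
Proof.
by have := @family_sum_ub _ _ _ [::] (norm2_bounded f); rewrite big_nil; apply.
Qed.

Lemma norm2_eq0 f : norm2 f = 0 -> f = 0.
Proof.
move=> f0; apply/val_inj/funext => i; apply/eqP.
by rewrite -sqrf_eq0 eq_le sqr_ge0 -f0 coord_le_norm2.
Qed.

(* Polarization turns identities for [ell2_dot] into identities between sums
   of squares, to which [eq_sum_norm2] applies. *)
Definition ell2_dot f g : R := (norm2 (f + g) - norm2 (f - g)) / 4.

Lemma ell2_dotC f g : ell2_dot f g = ell2_dot g f.
Proof.
by rewrite /ell2_dot [f + g]addrC -(opprB g f) norm2N.
Qed.

Lemma ell2_dotDl f g h : ell2_dot (f + g) h = ell2_dot f h + ell2_dot g h.
Proof.
rewrite /ell2_dot -mulrDl; congr (_ / _).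
apply: norm2_identity3 => i.
rewrite !(ell2D, ell2N); move: (val f i) (val g i) (val h i) => x y z.
by clear; ring.
Qed.

(** A nonnegative scalar is a square [b ^+ 2], and [b] can be moved inside the squared norms, which
    leaves a pointwise identity of squares. Negative scalars follow by oddness. *)
Lemma ell2_dotZl (c : R) f g : ell2_dot (c *: f) g = c * ell2_dot f g.
Proof.
have dotZ_ge0 (b : R) : 0 <= b -> ell2_dot (b *: f) g = b * ell2_dot f g.
  move=> b0; rewrite -(sqr_sqrtr b0); move: (Num.sqrt b) => {b0}b.
  rewrite /ell2_dot mulrA; congr (_ / _); rewrite mulrBr -!norm2Z.
  apply: norm2_identity2 => i.
  rewrite !(ell2Z, ell2D, ell2N); move: (val f i) (val g i) => x y.
  by clear; ring.
have [/dotZ_ge0//|c0] := leP 0 c.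
have dotN f' : ell2_dot (- f') g = - ell2_dot f' g.
  rewrite /ell2_dot -mulNr opprB -[- f' - g]opprD norm2N.
  by rewrite -(opprB g f') norm2N [g - f']addrC.
have := dotZ_ge0 (- c); rewrite oppr_ge0 (ltW c0) scaleNr dotN mulNr.
by move=> /(_ isT) /oppr_inj.
Qed.

Lemma ell2_dotff f : ell2_dot f f = norm2 f.
Proof.
rewrite /ell2_dot subrr -(scale0r f) -mulr2n -scaler_nat !norm2Z.
by field.
Qed.

Lemma norm2D f g : norm2 (f + g) = norm2 f + 2 * ell2_dot f g + norm2 g.
Proof.
rewrite -3!ell2_dotff ell2_dotDl !(ell2_dotC _ (f + g)) !ell2_dotDl.
rewrite (ell2_dotC g f).
by move: (ell2_dot f f) (ell2_dot f g) (ell2_dot g g); clear=> *; ring.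
Qed.

Lemma ell2_dot_le f g : ell2_dot f g <= Num.sqrt (norm2 f) * Num.sqrt (norm2 g).
Proof.
have dot0 h : ell2_dot 0 h = 0 by rewrite -(scale0r 0) ell2_dotZl mul0r.
set a := Num.sqrt _; set b := Num.sqrt _.
have a2 : a ^+ 2 = norm2 f by rewrite sqr_sqrtr// norm2_ge0.
have b2 : b ^+ 2 = norm2 g by rewrite sqr_sqrtr// norm2_ge0.
have a0 : 0 <= a by exact: sqrtr_ge0.
have b0 : 0 <= b by exact: sqrtr_ge0.
have [ab0|ab_le0] := ltP 0 (a * b); last first.
  have /eqP : a * b = 0 by apply/eqP; rewrite eq_le ab_le0 mulr_ge0.
  rewrite mulf_eq0 -[a == 0]sqrf_eq0 -[b == 0]sqrf_eq0 a2 b2.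
  move=> /orP[]/eqP/norm2_eq0 ->.
    by rewrite dot0 mulr_ge0.
  by rewrite ell2_dotC dot0 mulr_ge0.
(* With [a], [b] the norms of [f], [g], this squared norm is [2 a b (a b - <f, g>)], and [a b > 0]
   can be divided out. *)
have := norm2_ge0 (b *: f + (- a) *: g).
rewrite norm2D !norm2Z ell2_dotZl ell2_dotC ell2_dotZl sqrrN -a2 -b2.
rewrite (ell2_dotC g f); move: (ell2_dot f g) => d.
have -> : b ^+ 2 * a ^+ 2 + 2 * (b * (- a * d)) + a ^+ 2 * b ^+ 2 =
  2 * (a * b) * (a * b - d) by move: a b {a2 b2 a0 b0 ab0} => a b; clear; ring.
by rewrite pmulr_rge0 ?(mulr_gt0 _ ab0)// subr_ge0.
Qed.
End InnerProduct.

(** * Norm, completeness and the Hilbert space structure *)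

Section HilbertSpace.
Variables (R : realType) (I : choiceType).
Local Notation H := (ell2 R I).
Implicit Types (f g h : H) (i : I).

Definition ell2_norm f : R := Num.sqrt (norm2 f).

Lemma ell2_normD f g : ell2_norm (f + g) <= ell2_norm f + ell2_norm g.
Proof.
rewrite -(ler_pXn2r (n := 2))// ?nnegrE ?addr_ge0 ?sqrtr_ge0//.
rewrite sqrrD !sqr_sqrtr ?norm2_ge0// norm2D.
by rewrite lerD2r lerD2l -[leRHS]mulr_natl ler_pM2l// ell2_dot_le.
Qed.

Lemma ell2_normZ (c : R) f : ell2_norm (c *: f) = `|c| * ell2_norm f.
Proof. by rewrite /ell2_norm norm2Z sqrtrM ?sqr_ge0// sqrtr_sqr. Qed.

Lemma ell2_norm_eq0 f : ell2_norm f = 0 -> f = 0.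
Proof.
move=> /eqP; rewrite sqrtr_eq0 => f0; apply/norm2_eq0/eqP.
by rewrite eq_le f0 norm2_ge0.
Qed.

HB.instance Definition _ :=
  Lmodule_isNormed.Build R H ell2_normD ell2_normZ ell2_norm_eq0.

Lemma ell2_norm_sqr f : `|f| ^+ 2 = norm2 f.
Proof. by rewrite sqr_sqrtr// norm2_ge0. Qed.

Lemma coord_le_norm f i : `|val f i| <= `|f|.
Proof.
rewrite -(ler_pXn2r (n := 2))// ?nnegrE// ell2_norm_sqr real_normK ?num_real//.
exact: coord_le_norm2.
Qed.

Lemma ell2_cauchy_cvg (F : set_system H) : ProperFilter F -> cauchy F -> cvg F.
Proof.
move=> FF /cauchyP Fc.
have coord_cvg i : cvg ((fun f : H => val f i) @ F).
  apply: cauchy_cvg; apply: cauchy_exP => e e0.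
  have [x Fx] := Fc _ e0; exists (val x i).
  suff : F [set f : H | ball (val x i : R) e (val f i)] by [].
  apply: filterS Fx => f xf /=.
  suff : `|val x i - val f i| < e by rewrite -ball_normE.
  by rewrite -ell2N -ell2D (le_lt_trans (coord_le_norm _ _)).
pose l i : R := lim ((fun f : H => val f i) @ F).
(* A bound on finitely many coordinates survives the coordinatewise limit. Being uniform in [s], it
   later bounds the whole norm. *)
have dist_l (x : H) e s : F (ball x e) -> uniq s ->
    \sum_(i <- s) (val x i - l i) ^+ 2 <= e ^+ 2.
  move=> Fx us.
  have cvg_s : (fun f : H => \sum_(i <- s) (val x i - val f i) ^+ 2) @ F -->
      \sum_(i <- s) (val x i - l i) ^+ 2.
    elim: s {us} => [|i s IHs].
      by under eq_fun do rewrite big_nil; rewrite big_nil; exact: cvg_cst.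
    under eq_fun do rewrite big_cons; rewrite big_cons; apply: cvgD => //.
    by apply: cvgM; apply: cvgB; first [exact: cvg_cst|exact: coord_cvg].
  apply: (cvgr_to_le cvg_s); apply: filterS Fx => f xf.
  have -> : \sum_(i <- s) (val x i - val f i) ^+ 2 =
      \sum_(i <- s) val (x - f) i ^+ 2.
    by apply: eq_bigr => i _; rewrite ell2D ell2N.
  apply: le_trans (family_sum_ub (norm2_bounded _) us) _.
  rewrite -/(norm2 _) -ell2_norm_sqr.
  have := xf; rewrite -ball_normE /= => /ltW xfe.
  by rewrite ler_pXn2r ?nnegrE// (le_trans _ xfe).
have [x1 Fx1] := Fc _ ltr01.
have dP : (fun i => val x1 i - l i) \in @square_summable R I.
  by rewrite unfold_in; apply/asboolP; exists (1 ^+ 2) => s us; exact: dist_l.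
(* Square-summability is available for [x1 - l], not directly for [l], so the limit is obtained by
   subtraction. *)
pose g : H := x1 - Sub (fun i => val x1 i - l i) dP.
have gE i : val g i = l i by rewrite ell2D ell2N SubK opprB addrC subrK.
apply/cvg_ex; exists g; apply/cvgrPdist_lt => e e0.
have e20 : 0 < e / 2 by rewrite divr_gt0.
have [x Fx] := Fc _ e20; apply: filterS (Fx) => f.
rewrite -ball_normE /= => xf.
have -> : g - f = - (x - g) + (x - f) by rewrite opprB addrA subrK.
rewrite (le_lt_trans (ler_normD _ _))// normrN [e in _ < e]splitr ler_ltD//.
rewrite -(ler_pXn2r (n := 2))// ?nnegrE ?(ltW e20)// ell2_norm_sqr.
apply: family_sum_le => s us.
under eq_bigr do rewrite ell2D ell2N gE.
exact: dist_l.
Qed.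

HB.instance Definition _ := Uniform_isComplete.Build H ell2_cauchy_cvg.

Let dot := @ell2_dot R I : H -> H -> R.

Lemma ell2_dot_zmod_l g : zmod_morphism (dot ^~ g).
Proof.
move=> f h; rewrite /dot ell2_dotDl -scaleN1r ell2_dotZl.
by rewrite mulN1r.
Qed.

Lemma ell2_dot_zmod_r g : zmod_morphism (dot g).
Proof. by move=> f h; rewrite /dot !(ell2_dotC g); exact: ell2_dot_zmod_l. Qed.

Lemma ell2_dot_scale_l g : scalable_for *%R (dot ^~ g).
Proof. by move=> c f; rewrite /dot ell2_dotZl. Qed.

Lemma ell2_dot_scale_r g : scalable_for (idfun \; *%R) (dot g).
Proof. by move=> c f; rewrite /dot !(ell2_dotC g) ell2_dotZl. Qed.

HB.instance Definition _ := isBilinear.Build R H H R *%R (idfun \; *%R) dot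
  ell2_dot_zmod_l ell2_dot_zmod_r ell2_dot_scale_l ell2_dot_scale_r.

Lemma ell2_dot_hermitian f g : dot f g = (-1) ^+ false * idfun (dot g f).
Proof. by rewrite expr0 mul1r /dot ell2_dotC. Qed.

HB.instance Definition _ :=
  isHermitianSesquilinear.Build R H false idfun dot ell2_dot_hermitian.

Lemma ell2_dot_gt0 f : f != 0 -> 0 < dot f f.
Proof.
move=> f0; rewrite /dot ell2_dotff lt_neqAle norm2_ge0 andbT eq_sym.
by apply: contra_neq f0 => /norm2_eq0.
Qed.

HB.instance Definition _ := isDotProduct.Build R H dot ell2_dot_gt0.

Lemma ell2_dot_norm f : `|f| ^+ 2 = dot f f.
Proof. by rewrite ell2_norm_sqr /dot ell2_dotff. Qed.

Definition ell2_hilbert : real_hilbert R :=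
  @RealHilbert R H (dot : {dot H for idfun}) ell2_dot_norm.

Lemma ell2_hilbert_dotE (f g : H) : hdot ell2_hilbert f g = ell2_dot f g.
Proof. by []. Qed.

End HilbertSpace.

(** * Multiplication operators and the rotation *)

Section MultiplicationOperators.
Variables (R : realType) (I : choiceType).
Local Notation H := (ell2 R I).
Implicit Types (m : I -> R) (f g : H).

Definition bounded_family m : Prop := exists M : R, forall i, `|m i| <= M.

(* Multiplication by a family that is not bounded has the junk value [0]. *)
Definition mulop m f : H := insubd 0 (fun i => m i * val f i).

Lemma mulop_square_summable m f : bounded_family m ->
  (fun i => m i * val f i) \in @square_summable R I.
Proof.
move=> [M mM]; rewrite unfold_in; apply/asboolP.
apply: le_bounded_sums (bounded_sumsZ (sqr_ge0 M) (norm2_bounded f)) => i.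
rewrite exprMn ler_wpM2r ?sqr_ge0// -real_normK ?num_real//.
by rewrite ler_pXn2r ?nnegrE// (le_trans _ (mM i)).
Qed.

Lemma mulopE m f i : bounded_family m -> val (mulop m f) i = m i * val f i.
Proof. by move=> bm; rewrite val_insubd mulop_square_summable. Qed.

Lemma mulop_linear m : bounded_family m -> linear (mulop m).
Proof.
move=> bm c f g; apply/val_inj/funext => i.
by rewrite !(mulopE, ell2E)// mulrDr mulrCA.
Qed.

Lemma norm_mulop m (M : R) f : 0 <= M -> (forall i, `|m i| <= M) ->
  `|mulop m f| <= M * `|f|.
Proof.
move=> M0 mM; have bm : bounded_family m by exists M.
rewrite -(ler_pXn2r (n := 2))// ?nnegrE ?mulr_ge0// exprMn !ell2_norm_sqr.
rewrite -norm2Z; have := @le_sum_norm2 _ _ [:: mulop m f] [:: M *: f].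
rewrite !big_seq1; apply => i; rewrite !big_seq1 mulopE// ell2Z !exprMn.
rewrite ler_wpM2r ?sqr_ge0// -[m i ^+ 2]real_normK ?num_real//.
by rewrite ler_pXn2r ?nnegrE.
Qed.

Lemma mulop_dot m f g : bounded_family m ->
  ell2_dot (mulop m f) g = ell2_dot f (mulop m g).
Proof.
move=> bm; rewrite /ell2_dot; congr (_ / _).
have := @norm2_identity2 _ _ (mulop m f + g) (f - mulop m g)
  (mulop m f - g) (f + mulop m g); apply => i.
rewrite !(ell2D, ell2N, mulopE)//; move: (m i) (val f i) (val g i) => x y z.
by clear; ring.
Qed.

(** By polarization it suffices to compare [m f - f] with [m f + f] coordinatewise; their squares
    differ by [4 m f ^+ 2]. *)
Lemma mulop_dot_ge0 m f : bounded_family m -> (forall i, 0 <= m i) ->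
  0 <= ell2_dot (mulop m f) f.
Proof.
move=> bm m0; rewrite divr_ge0// subr_ge0.
have := @le_sum_norm2 _ _ [:: mulop m f - f] [:: mulop m f + f].
rewrite !big_seq1; apply => i; rewrite !big_seq1 !(ell2D, ell2N, mulopE)//.
have : 0 <= m i * val f i ^+ 2 by rewrite mulr_ge0// sqr_ge0.
by move: (m i) (val f i) => x y; clear; nra.
Qed.

Lemma delta_square_summable (i : I) :
  (fun j => (j == i)%:R : R^o) \in @square_summable R I.
Proof.
rewrite unfold_in; apply/asboolP; exists 1 => s us.
have [is_|ns] := boolP (i \in s).
  rewrite (bigD1_seq i)//= eqxx expr1n big1 ?addr0// => j /negPf ->.
  by rewrite expr0n.
rewrite big_seq big1// => j js; rewrite (_ : j == i = false) ?expr0n//.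
by apply: contraNF ns => /eqP <-.
Qed.

Definition ell2_delta (i : I) : H :=
  Sub (fun j => (j == i)%:R : R^o) (delta_square_summable i).

Lemma ell2_deltaE i j : val (ell2_delta i) j = (j == i)%:R.
Proof. by rewrite SubK. Qed.

Lemma ell2_delta_dot_gt0 i : 0 < ell2_dot (ell2_delta i) (ell2_delta i).
Proof.
rewrite ell2_dotff (lt_le_trans _ (coord_le_norm2 _ i))//.
by rewrite ell2_deltaE eqxx expr1n.
Qed.

Lemma mulop_delta m i : bounded_family m ->
  mulop m (ell2_delta i) = m i *: ell2_delta i.
Proof.
move=> bm; apply/val_inj/funext => j; rewrite mulopE// ell2Z !ell2_deltaE.
by have [->//|_] := eqVneq j i; rewrite !mulr0.
Qed.

End MultiplicationOperators.

Section Rotation.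
Variables (R : realType) (J : choiceType).
Local Notation I := (J * bool)%type.
Local Notation H := (ell2 R I).
Implicit Types (f g : H).

Let flip (i : I) : I := (i.1, ~~ i.2).

Let flipK : involutive flip.
Proof. by move=> [j b]; rewrite /flip negbK. Qed.

Let rotfun f (i : I) : R^o := (-1) ^+ i.2 * val f (flip i).

Let sum_rotfun f (s : seq I) :
  \sum_(i <- s) rotfun f i ^+ 2 =
  \sum_(i <- [seq flip i | i <- s]) val f i ^+ 2.
Proof.
by rewrite big_map; apply: eq_bigr => i _; rewrite exprMn sqrr_sign mul1r.
Qed.

Let rotfun_square_summable f : rotfun f \in @square_summable R I.
Proof.
rewrite unfold_in; apply/asboolP; exists (norm2 f) => s us.
rewrite sum_rotfun; apply: family_sum_ub; first exact: norm2_bounded.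
by rewrite map_inj_uniq//; exact: can_inj flipK.
Qed.

(** A quarter turn in each plane of coordinates [(j, false)], [(j, true)]: it sends [(p, q)] to
    [(q, - p)]. It supplies the skew-adjoint part of the blocks. *)
Definition rotation f : H := Sub (rotfun f) (rotfun_square_summable f).

Lemma rotationE f (j : J) (b : bool) :
  val (rotation f) (j, b) = (-1) ^+ b * val f (j, ~~ b).
Proof. by rewrite SubK. Qed.

Lemma rotation_linear : linear rotation.
Proof.
move=> c f g; apply/val_inj/funext => -[j b].
by rewrite ell2E !rotationE ell2E mulrDr mulrCA.
Qed.

Lemma rotationK f : rotation (rotation f) = - f.
Proof.
apply/val_inj/funext => -[j b]; rewrite ell2N !rotationE negbK.
by case: b; rewrite /= expr0 expr1 ?mulN1r ?mul1r ?mulN1r.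
Qed.

(** Reindexing finite sums by [flip] gives one inequality. The other is the same inequality at
    [rotation f], since the rotation squares to [- 1]. *)
Lemma norm2_rotation f : norm2 (rotation f) = norm2 f.
Proof.
have le_rot g : norm2 (rotation g) <= norm2 g.
  apply: family_sum_le => s us.
  rewrite [leLHS](sum_rotfun g).
  apply: family_sum_ub; first exact: norm2_bounded.
  by rewrite map_inj_uniq//; exact: can_inj flipK.
apply/eqP; rewrite eq_le le_rot/= -[leLHS]norm2N -rotationK.
exact: le_rot.
Qed.

(** An isometry with square [- 1] is skew-adjoint: rotate both vectors in the polarization
    formula. *)
Lemma rotation_dot f g : ell2_dot (rotation f) g = - ell2_dot f (rotation g).
Proof.
have rotD f1 f2 : rotation (f1 + f2) = rotation f1 + rotation f2.
  by apply/val_inj/funext => -[j b]; rewrite ell2D !rotationE ell2D mulrDr.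
have rotN f1 : rotation (- f1) = - rotation f1.
  by apply/val_inj/funext => -[j b]; rewrite ell2N !rotationE ell2N mulrN.
rewrite /ell2_dot -mulNr opprB; congr (_ / _).
rewrite -(norm2_rotation (rotation f + g)) -(norm2_rotation (rotation f - g)).
rewrite !rotD rotN !rotationK -opprD norm2N.
by rewrite -(norm2N (f - _)) opprB [- f + _]addrC.
Qed.

Lemma norm_rotation f : `|rotation f| = `|f|.
Proof. by congr Num.sqrt; exact: norm2_rotation. Qed.

Lemma mulop_rotation (m : J -> R) f : bounded_family m ->
  mulop (fun i => m i.1) (rotation f) = rotation (mulop (fun i => m i.1) f).
Proof.
move=> [M mM]; have bm : bounded_family (fun i : I => m i.1).
  by exists M => i; exact: mM.
apply/val_inj/funext => -[j b]; rewrite mulopE// !rotationE mulopE//=.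
by rewrite mulrCA.
Qed.

End Rotation.

(** * Operator systems of two-by-two blocks *)

Section BlockRepresentation.
Variables (R : realType) (V : lmodType R) (star : V -> V) (pos : set V) (e : V).
Variables (J : choiceType) (a c : V -> J -> R).
Hypothesis a_linear : forall j, linear ((a^~ j) : V -> R^o).
Hypothesis c_linear : forall j, linear ((c^~ j) : V -> R^o).
Hypothesis a_bounded : forall x, bounded_family (a x).
Hypothesis c_bounded : forall x, bounded_family (c x).
Hypothesis a_star : forall x j, a (star x) j = a x j.
Hypothesis c_star : forall x j, c (star x) j = - c x j.
Hypothesis a_unit : forall j, a e j = 1.
Hypothesis e_selfadjoint : star e = e.
Hypothesis posP : forall x, pos x <-> star x = x /\ forall j, 0 <= a x j.
Hypothesis ac_injective : forall x,
  (forall j, a x j = 0) -> (forall j, c x j = 0) -> x = 0.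

Local Notation H := (ell2_hilbert R (J * bool)%type).

(* On the two coordinates [(j, false)] and [(j, true)] this is the matrix
   [[a x j, c x j], [- c x j, a x j]]. *)
Definition block (x : V) (h : H) : H :=
  mulop (fun i => a x i.1) h + mulop (fun i => c x i.1) (rotation h).

Let ba x : bounded_family (fun i : J * bool => a x i.1).
Proof. by have [M aM] := a_bounded x; exists M => i; exact: aM. Qed.

Let bc x : bounded_family (fun i : J * bool => c x i.1).
Proof. by have [M cM] := c_bounded x; exists M => i; exact: cM. Qed.

Lemma blockE x (h : H) j b : val (block x h) (j, b) =
  a x j * val h (j, b) + c x j * ((-1) ^+ b * val h (j, ~~ b)).
Proof. by rewrite /block ell2D !mulopE// rotationE. Qed.

Lemma block_linear_l (t : R) x y : block (t *: x + y) = t *: block x + block y.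
Proof.
apply/funext => h; apply/val_inj/funext => -[j b].
rewrite -[(t *: _ + _) h]/(t *: block x h + block y h) ell2E !blockE.
have -> : a (t *: x + y) j = t * a x j + a y j by exact: a_linear.
have -> : c (t *: x + y) j = t * c x j + c y j by exact: c_linear.
rewrite !mulrDl mulrDr !mulrA addrACA.
by [].
Qed.

Lemma block_bounded x : bounded_operator (block x).
Proof.
split.
  move=> t h k; rewrite /block (@rotation_linear _ _ t h k).
  by rewrite !mulop_linear// scalerDr addrACA.
have [M aM] := ba x; have [N cN] := bc x.
exists (`|M| + `|N|) => h; rewrite mulrDl (le_trans (ler_normD _ _))// lerD//.
  by apply: norm_mulop => // i; rewrite (le_trans (aM i))// ler_norm.
rewrite -(norm_rotation h).
by apply: norm_mulop => // i; rewrite (le_trans (cN i))// ler_norm.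
Qed.

Lemma block_unit : block e = idfun.
Proof.
apply/funext => h; apply/val_inj/funext => -[j b]; rewrite blockE a_unit mul1r.
have c0 : c e j = 0.
  by apply/eqP; rewrite -eqNr -c_star e_selfadjoint.
by rewrite c0 mul0r addr0.
Qed.

(** The family [c x] is constant on each plane, so its multiplication operator commutes with the
    rotation; their product is skew-adjoint. *)
Let skew_dot x (h k : H) :
  ell2_dot (mulop (fun i => c x i.1) (rotation h)) k =
  - ell2_dot h (mulop (fun i => c x i.1) (rotation k)).
Proof.
by rewrite mulop_rotation// rotation_dot mulop_dot// mulop_rotation.
Qed.

Lemma block_adjoint x : is_adjoint (block x) (block (star x)).
Proof.
have aE : (fun i : J * bool => a (star x) i.1) = (fun i => a x i.1).
  by apply/funext => i; rewrite a_star.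
have cE (k : H) : mulop (fun i : J * bool => c (star x) i.1) (rotation k) =
    -1 *: mulop (fun i => c x i.1) (rotation k).
  by apply/val_inj/funext => i; rewrite ell2Z !mulopE// c_star mulN1r mulNr.
move=> h k; rewrite !ell2_hilbert_dotE /block ell2_dotDl skew_dot mulop_dot//.
rewrite aE cE [RHS]ell2_dotC ell2_dotDl ell2_dotZl mulN1r.
by rewrite !(ell2_dotC h).
Qed.

(** The skew part contributes a number equal to its opposite, so positivity of the form depends on
    [a] alone. *)
Lemma block_form x (h : H) : hdot H (block x h) h =
  ell2_dot (mulop (fun i => a x i.1) h) h.
Proof.
rewrite ell2_hilbert_dotE ell2_dotDl.
set d := ell2_dot (mulop _ (rotation h)) h.
have d0 : - d = d by rewrite {2}/d skew_dot ell2_dotC.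
have /eqP -> : d == 0 by rewrite -eqNr d0.
exact: addr0.
Qed.

(** The image of the basis vector at [(j, false)] has coordinates [a x j] and [- c x j] in its
    plane. *)
Lemma block_injective x : block x = 0 -> x = 0.
Proof.
move=> x0; have coord j b b' : val (block x (ell2_delta R (j, b))) (j, b') = 0.
  by rewrite x0.
apply: ac_injective => j.
  have := coord j false false; rewrite blockE !ell2_deltaE eqxx mulr1.
  by rewrite xpair_eqE andbF !mulr0 addr0.
have := coord j false true; rewrite blockE !ell2_deltaE eqxx mulr1.
rewrite xpair_eqE andbF mulr0 add0r expr1 mulrN1 => /eqP.
by rewrite oppr_eq0 => /eqP.
Qed.

Let block_set : set (H -> H) := range block.

Let block0 : block 0 = 0.
Proof.
have := block_linear_l 1 0 0; rewrite !scale1r !addr0 => b0.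
by apply: (addrI (block 0)); rewrite -b0 addr0.
Qed.

Lemma block_set_bounded : block_set `<=` @bounded_operator R H.
Proof. by move=> _ [x _ <-]; exact: block_bounded. Qed.

Lemma block_set_zero : block_set 0.
Proof. by exists 0 => //; exact: block0. Qed.

Lemma block_set_linear (t : R) T T' :
  block_set T -> block_set T' -> block_set (t *: T + T').
Proof.
by move=> [x _ <-] [y _ <-]; exists (t *: x + y); rewrite ?block_linear_l.
Qed.

Lemma block_set_unital : block_set idfun.
Proof. by exists e; rewrite ?block_unit. Qed.

Lemma block_set_selfadjoint T : block_set T ->
  exists2 T', block_set T' & is_adjoint T T'.
Proof.
move=> [x _ <-]; exists (block (star x)); last exact: block_adjoint.
by exists (star x).
Qed.

Definition block_system : operator_system H :=
  OperatorSystem block_set_bounded block_set_zero block_set_linear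
    block_set_unital block_set_selfadjoint.

Let block_mem x : block x \in opsys_pred block_system.
Proof. by apply: mem_set; exists x. Qed.

Definition block_map (x : V) : block_system := Sub (block x) (block_mem x).

Let block_map_linear : linear block_map.
Proof. by move=> t x y; apply: val_inj; exact: block_linear_l. Qed.

HB.instance Definition _ :=
  GRing.isLinear.Build R V block_system *:%R block_map block_map_linear.

Lemma block_map_embedding : unital_order_embedding star pos e
  (opsys_star block_system) (opsys_pos block_system) (opsys_one block_system)
  block_map.
Proof.
have inj : injective block_map.
  move=> x y /(congr1 val) xy; apply/eqP; rewrite -subr_eq0; apply/eqP.
  apply: block_injective; rewrite addrC -scaleN1r block_linear_l.
  by rewrite -[block x]/(val (block_map x)) xy scaleN1r addNr.
have starE x : opsys_star block_system (block_map x) = block_map (star x).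
  exact/opsys_starE/block_adjoint.
split=> // [|x].
  by apply: val_inj; exact: block_unit.
rewrite posP; split=> [[x_sa x0]|[x_sa x0]]; split.
- by rewrite starE x_sa.
- by move=> h; rewrite block_form mulop_dot_ge0// => i; exact: x0.
- by apply: inj; rewrite -starE.
(* At a basis vector the form is [a x j] times a positive number. *)
- move=> j; have := x0 (ell2_delta R (j, false)).
  rewrite block_form mulop_delta// ell2_dotZl pmulr_lge0//.
  exact: ell2_delta_dot_gt0.
Qed.

End BlockRepresentation.

(** * The representation theorem *)

Section States.
Variables (R : realType) (V : lmodType R) (star : V -> V) (pos : set V) (e : V).
Hypothesis aou : archimedean_order_unit_space star pos e.

(** Positivity is tested on the symmetrization [x + star x]. Skew elements and their opposites have
    symmetrization [0], so a state vanishes on them and is invariant under [star]. *)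
Definition is_state (f : V -> R) : Prop :=
  [/\ linear (f : V -> R^o), f e = 1 &
    forall x, pos (x + star x) -> 0 <= f x].

Lemma aou_starK : involutive star.
Proof. exact: (aou_star aou).2. Qed.

Lemma aou_starD x y : star (x + y) = star x + star y.
Proof. by rewrite -[x in LHS]scale1r (aou_star aou).1 scale1r. Qed.

Lemma aou_star0 : star 0 = 0.
Proof. by apply: (addrI (star 0)); rewrite -aou_starD !addr0. Qed.

Lemma aou_starZ (t : R) x : star (t *: x) = t *: star x.
Proof. by rewrite -[t *: x]addr0 (aou_star aou).1 aou_star0 addr0. Qed.

Lemma aou_starN x : star (- x) = - star x.
Proof. by rewrite -scaleN1r aou_starZ scaleN1r. Qed.

Lemma aou_posD x y : pos x -> pos y -> pos (x + y).
Proof. by have [_ + _] := aou_cone aou; exact. Qed.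

Lemma aou_posZ (t : R) x : 0 <= t -> pos x -> pos (t *: x).
Proof. by have [_ _ +] := aou_cone aou; exact. Qed.

Lemma aou_pos0 : pos 0.
Proof.
suff : (pos `&` [set x | pos (- x)]) 0 by case.
by rewrite (aou_proper aou).
Qed.

Lemma aou_pos_antisym x : pos x -> pos (- x) -> x = 0.
Proof.
move=> px nx; suff : (pos `&` [set x | pos (- x)]) x.
  by rewrite (aou_proper aou).
by split.
Qed.

Lemma aou_pos_star x : pos x -> star x = x.
Proof. by have [+ _ _] := aou_cone aou; exact. Qed.

Lemma aou_pos_unit : pos e.
Proof.
have [t t0] := (aou_unit aou).2 0 aou_star0; rewrite addr0 => te.
rewrite -[e]scale1r -(mulVf (lt0r_neq0 t0)) -scalerA.
by apply: aou_posZ => //; rewrite invr_ge0 ltW.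
Qed.

Let e_star : star e = e := aou_pos_star aou_pos_unit.

Lemma pos_addstar x : star x = x -> pos (x + star x) -> pos x.
Proof.
move=> -> /(aou_posZ (t := 2^-1)); rewrite invr_ge0 ler0n => /(_ isT).
rewrite -[x + x]mulr2n -[x *+ 2]scaler_nat scalerA mulVf ?pnatr_eq0//.
by rewrite scale1r.
Qed.

Lemma stateE f (t : R) x y : is_state f -> f (t *: x + y) = t * f x + f y.
Proof. by move=> [fL _ _]; rewrite fL. Qed.

Lemma stateB f x y : is_state f -> f (x - y) = f x - f y.
Proof. by move=> fst; rewrite addrC -scaleN1r stateE// mulN1r addrC. Qed.

Lemma stateZ f (t : R) x : is_state f -> f (t *: x) = t * f x.
Proof.
move=> fst; rewrite -[t *: x]addr0 stateE// -(subrr x) stateB// subrr.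
exact: addr0.
Qed.

Lemma stateN f x : is_state f -> f (- x) = - f x.
Proof. by move=> fst; rewrite -scaleN1r stateZ// mulN1r. Qed.

Lemma state_star f x : is_state f -> f (star x) = f x.
Proof.
move=> fst; have [_ _ f0] := fst.
have skew y : pos (y - star y + star (y - star y)).
  rewrite aou_starD aou_starN aou_starK [X in _ + X]addrC addrACA subrr addNr.
  by rewrite addr0; exact: aou_pos0.
apply/eqP; rewrite eq_le -subr_ge0 -[_ <= f _]subr_ge0 -!stateB// !f0//.
by have := skew (star x); rewrite aou_starK.
Qed.

(** The bound is uniform over states, as needed for a bounded diagonal operator. If
    [t e - (y + star y)] is positive, then [(t / 2) e - y] has positive symmetrization and every
    state satisfies [f y <= t / 2]. *)
Lemma state_bounded x : exists M : R, forall f, is_state f -> `|f x| <= M.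
Proof.
have upper y : exists M : R, forall f, is_state f -> f y <= M.
  have y_sa : star (- (y + star y)) = - (y + star y).
    by rewrite aou_starN aou_starD aou_starK [star y + y]addrC.
  have [t t0 pt] := (aou_unit aou).2 _ y_sa; exists (t / 2) => f fst.
  have [_ f1 f0] := fst.
  suff : 0 <= f ((t / 2) *: e - y).
    by rewrite stateB// stateZ// f1 mulr1 subr_ge0.
  apply: f0; rewrite aou_starD aou_starN aou_starZ e_star addrACA -scalerDl.
  by rewrite -splitr -opprD.
have [M fM] := upper x; have [N fN] := upper (- x).
exists (Num.max M N) => f fst; rewrite ler_norml lerNl le_max.
by rewrite le_max fM// -stateN// fN// orbT.
Qed.

Lemma state_separation x : (e = 0 -> x = 0) -> star x = x ->
  (forall f, is_state f -> 0 <= f x) -> pos x.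
Proof.
move=> e0 x_sa fx0; apply: contrapT => npx.
have [t t0 npy] : exists2 t : R, 0 < t & ~ pos (t *: e + x).
  apply: contrapT => nt; apply: npx; apply: (aou_archimedean aou) => // t t0.
  by apply: contrapT => npt; apply: nt; exists t.
set y := t *: e + x in npy.
have y_sa : star y = y by rewrite aou_starD aou_starZ e_star x_sa.
(* This cone lives in all of [V] and contains every skew element, so the resulting functional is a
   state on [V] without a separate extension. *)
pose D0 := [set v | pos (v + star v)].
have coneD0 : convex_cone D0.
  split=> [v w Dv Dw|s v s0 Dv]; rewrite /D0 /=.
    by rewrite aou_starD addrACA; exact: aou_posD.
  by rewrite aou_starZ -scalerDr; exact: aou_posZ.
have nD0y : ~ D0 y by move=> Dy; exact/npy/pos_addstar.
have coneC := convex_cone_addray (- y) coneD0.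
set C := [set _ | _] in coneC.
have D0C : D0 `<=` C by move=> v Dv; exists v, 0; rewrite scale0r addr0.
have D00 : D0 0 by rewrite /D0 /= aou_star0 addr0; exact: aou_pos0.
have D0e : D0 e by rewrite /D0 /= e_star; apply: aou_posD; exact: aou_pos_unit.
(* Suppose [- e = c - s y] with [c] in [D0]. If [s = 0], then [- e] is positive, so [e = 0] and
   [x = 0] is positive. Otherwise [y = (c + e) / s] lies in [D0]. *)
have nCe : ~ C (- e).
  move=> [c [s [Dc s0 eE]]]; have [s00|s_neq0] := eqVneq s 0.
    apply: npx; rewrite e0; first exact: aou_pos0.
    apply: aou_pos_antisym; first exact: aou_pos_unit.
    apply: pos_addstar; first by rewrite aou_starN e_star.
    by rewrite eE s00 scale0r addr0.
  apply: nD0y; have -> : y = s^-1 *: (c + e).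
    apply: (scalerI s_neq0); rewrite scalerA divff// scale1r.
    by rewrite -[e]opprK eE scalerN opprD addrA subrr add0r opprK.
  by apply: coneD0.2; [rewrite invr_ge0|apply: coneD0.1].
have [D [coneD CD nDe Dtot]] := total_cone_extension coneC (D0C _ D00) nCe.
have De v : exists2 s : R, 0 < s & D (s *: e + v).
  have v_sa : star (v + star v) = v + star v.
    by rewrite aou_starD aou_starK addrC.
  have [s s0 ps] := (aou_unit aou).2 _ v_sa; exists (s / 2).
    by rewrite divr_gt0.
  apply/CD/D0C; rewrite /D0 /= aou_starD aou_starZ e_star addrACA.
  by rewrite -scalerDl -splitr.
have [f [fL f1 f0]] := total_cone_state coneD nDe Dtot De.
have fst : is_state f by split=> // v Dv; apply/f0/CD/D0C.
(* This contradicts [f y = t + f x > 0]. *)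
have : 0 <= f (- y).
  by apply/f0/CD; exists 0, 1; rewrite scale1r add0r.
by rewrite stateN// stateE// f1 mulr1 oppr_ge0 leNgt ltr_wpDr// fx0.
Qed.

End States.

Theorem theorem9p20 (R : realType) :
  (forall (V : lmodType R) (star : V -> V) (pos : set V) (e : V),
     archimedean_order_unit_space star pos e ->
     (* excludes only the degenerate case V_sa = 0 <> V *)
     (e = 0 -> forall x : V, x = 0) ->
     exists (H : real_hilbert R) (S : operator_system H) (u : {linear V -> S}),
       unital_order_embedding star pos e
         (opsys_star S) (opsys_pos S) (opsys_one S) u) /\
  (forall (H : real_hilbert R) (S : operator_system H),
     archimedean_order_unit_space
       (opsys_star S) (opsys_pos S) (opsys_one S)).
Proof.
split=> [V star pos e aou e0|H S]; last exact: opsys_aou.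
have [phi [phiL phi_bounded phi_inj]] := bounded_function_embedding V.
(* All pairs of a state and a coordinate of [phi] are used; [a] depends only on the state, [c] only
   on the coordinate. Taking [phi] at [x - star x] makes [c] odd under [star]. *)
pose J := ({f : V -> R | `[< is_state star pos e f >]} * V)%type.
pose a (x : V) (j : J) := val j.1 x.
pose c (x : V) (j : J) := phi (x - star x) j.2.
have stP (j : J) : is_state star pos e (val j.1) by exact/asboolP/(valP j.1).
have phiE (t : R) x y z : phi (t *: x + y) z = t * phi x z + phi y z.
  exact: phiL.
have starK := aou_starK aou.
have phiN x z : phi (- x) z = - phi x z.
  have phi0 : phi 0 z = 0.
    have := phiE 1 0 0 z; rewrite scaler0 addr0 mul1r => /esym/eqP.
    by rewrite -subr_eq0 addrK => /eqP.
  by rewrite -[- x]addr0 -scaleN1r phiE phi0 addr0 mulN1r.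
have aL j : linear ((a^~ j) : V -> R^o) by move=> t x y; exact: stateE.
have cL j : linear ((c^~ j) : V -> R^o).
  move=> t x y; rewrite /c -phiE (aou_starD aou) (aou_starZ aou).
  by rewrite opprD addrACA scalerBr.
have ab x : bounded_family (a x).
  by have [M fM] := state_bounded aou x; exists M => j; exact: fM.
have cb x : bounded_family (c x).
  by have [M fM] := phi_bounded (x - star x); exists M => j; exact: fM.
have a_star x j : a (star x) j = a x j by apply: (state_star aou); exact: stP.
have c_star x j : c (star x) j = - c x j by rewrite /c starK -phiN opprB.
have a_unit j : a e j = 1 by have [] := stP j.
have e_sa := aou_pos_star aou (aou_pos_unit aou).
have posP x : pos x <-> star x = x /\ forall j, 0 <= a x j.
  split=> [px|[x_sa ax]].
    have x_sa := aou_pos_star aou px; split=> // j; have [_ _] := stP j; apply.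
    by rewrite x_sa; exact: (aou_posD aou).
  apply: (state_separation aou) => [/e0||f fst] //.
  exact: (ax (Sub f (asboolT fst), 0)).
have ac_inj x : (forall j, a x j = 0) -> (forall j, c x j = 0) -> x = 0.
  move=> ax cx.
  (* Without states, [posP] holds vacuously for [- e], which forces [e = 0] and hence [V = 0]. With
     a state at hand, every coordinate of [phi] occurs in [J], so [c x = 0] gives [x = star x], and
     [a x = 0] makes both [x] and [- x] positive. *)
  have [j0|noJ] := pselect (exists j : J, True); last first.
    apply: e0; apply: (aou_pos_antisym aou (aou_pos_unit aou)).
    apply/posP; split=> [|j]; first by rewrite (aou_starN aou) e_sa.
    by case: noJ; exists j.
  have x_sa : x = star x.
    apply/eqP; rewrite -subr_eq0; apply/eqP/phi_inj => z.
    by have [j _] := j0; exact: (cx (j.1, z)).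
  apply: (aou_pos_antisym aou); (apply/posP; split=> [|j]).
  - by rewrite -x_sa.
  - by rewrite ax.
  - by rewrite (aou_starN aou) -x_sa.
  - by rewrite /a (stateN _ (stP j)) -/(a x j) ax oppr0.
exists (ell2_hilbert R (J * bool)%type).
exists (block_system aL cL ab cb a_star c_star a_unit e_sa).
eexists.
exact: (block_map_embedding aL cL ab cb a_star c_star a_unit e_sa posP ac_inj).
Qed.
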